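(* Let $(M,g)$ be a Riemannian manifold of dimension $n$, with Ricci curvature $r_{g}$ and scalar curvature $s_{g}$, and assume that $s_{g}$ is constant on $M$. If at every point of $M$ all eigenvalues $\lambda$ of $r_{g}$ with respect to $g$ satisfy $\lambda \geq \frac{1}{n}s_{g}$, then $(M,g)$ is an Einstein manifold.
   Context: The Ricci curvature of $(M,g)$ is the symmetric 2-tensor $r_{g}(X,Y)=\mathrm{tr}\,(Z\mapsto R(X,Z)Y)$, where $R$ is the Riemann curvature tensor of the Levi-Civita connection (with the sign convention for $R$ making this the usual Ricci tensor). The scalar curvature is $s_{g}=\mathrm{tr}\,r_{g}$, the trace taken with respect to $g$. The eigenvalues of $r_{g}$ with respect to $g$ at $x\in M$ are the eigenvalues of the $g$-self-adjoint endomorphism $A_x$ of $T_xM$ defined by $g(A_xu,v)=r_{g}(u,v)$. $(M,g)$ is called an Einstein manifold if there exists a real constant $\lambda$ such that $r_{g}(X,Y)=\lambda g(X,Y)$ for all vector fields $X,Y$ on $M$. No compactness of $M$ is assumed. *)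

(* Defs.v *)
From HB Require Import structures.
From mathcomp Require Import all_boot all_order all_algebra.
From mathcomp Require Import all_classical all_reals all_analysis.
From mathcomp Require Import ring.

Set Implicit Arguments.
Unset Strict Implicit.
Unset Printing Implicit Defensive.

Import Order.TTheory GRing.Theory Num.Theory.
Import numFieldNormedType.Exports.

Local Open Scope classical_set_scope.
Local Open Scope ring_scope.

Definition partial {R : realType} {n : nat} {W : normedModType R} (i : 'I_n)
    (f : 'rV[R]_n -> W) : 'rV[R]_n -> W :=
  fun y => 'D_(delta_mx 0 i) f y.

Fixpoint Ck_on {R : realType} {n : nat} {W : normedModType R} (k : nat)
    (U : set 'rV[R]_n) (f : 'rV[R]_n -> W) : Prop :=
  (forall y, U y -> {for y, continuous f}) /\
  match k with
  | 0%N => True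
  | k'.+1 => forall i : 'I_n,
      (forall y, U y -> derivable f y (delta_mx 0 i)) /\
      Ck_on k' U (partial i f)
  end.

Definition smooth_on {R : realType} {n : nat} {W : normedModType R}
    (U : set 'rV[R]_n) (f : 'rV[R]_n -> W) : Prop :=
  forall k, Ck_on k U f.

(* [chart_fun] and [chart_inv] are total functions; only their values on
   [chart_dom] and on [chart_fun @` chart_dom] are meaningful. *)
Record chart (R : realType) (n : nat) (T : topologicalType) := Chart {
  chart_dom : set T;
  chart_fun : T -> 'rV[R]_n;
  chart_inv : 'rV[R]_n -> T;
  chart_dom_open : open chart_dom;
  chart_img_open : open (chart_fun @` chart_dom);
  chart_funK : {in chart_dom, cancel chart_fun chart_inv};
  chart_fun_continuous : {in chart_dom, continuous chart_fun};
  chart_inv_continuous : {in chart_fun @` chart_dom, continuous chart_inv}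
}.

Definition chart_img {R : realType} {n : nat} {T : topologicalType}
    (c : chart R n T) : set 'rV[R]_n :=
  chart_fun c @` chart_dom c.

Record manifold (R : realType) (n : nat) := Manifold {
  carrier :> topologicalType;
  atlas : set (chart R n carrier);
  manifold_hausdorff : hausdorff_space carrier;
  manifold_second_countable : @second_countable carrier;
  atlas_cover : forall x : carrier, exists c, atlas c /\ chart_dom c x;
  atlas_compatible : forall c d, atlas c -> atlas d ->
    smooth_on (chart_fun c @` (chart_dom c `&` chart_dom d))
      (chart_fun d \o chart_inv c)
}.

(* A chosen chart around each point.  The tangent space T_xM is identified with
   'rV[R]_n through the coordinates of [chart_at x]; tangent vectors are row
   vectors, and endomorphisms of T_xM act by right multiplication. *)
Definition chart_at {R : realType} {n : nat} {M : manifold R n} (x : M) :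
    chart R n M :=
  projT1 (cid (atlas_cover x)).

(* v |-> v *m coord_change c d x turns the components of a tangent vector at x
   in the chart c into its components in the chart d. *)
Definition coord_change {R : realType} {n : nat} {M : manifold R n}
    (c d : chart R n M) (x : M) : 'M[R]_n :=
  'J (chart_fun d \o chart_inv c) (chart_fun c x).

Definition local_field {R : realType} {n : nat} {M : manifold R n}
    (X : M -> 'rV[R]_n) (c : chart R n M) : 'rV[R]_n -> 'rV[R]_n :=
  fun y => let x := chart_inv c y in X x *m coord_change (chart_at x) c x.

Definition smooth_vector_field {R : realType} {n : nat} {M : manifold R n}
    (X : M -> 'rV[R]_n) : Prop :=
  forall c, atlas c -> smooth_on (chart_img c) (local_field X c).

Definition bil {R : realType} {n : nat} (G : 'M[R]_n) (u v : 'rV[R]_n) : R :=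
  (u *m G *m v^T) 0 0.

Definition local_metric {R : realType} {n : nat} {M : manifold R n}
    (g : M -> 'M[R]_n) (c : chart R n M) : 'rV[R]_n -> 'M[R]_n :=
  fun y => let x := chart_inv c y in
    let J := coord_change c (chart_at x) x in J *m g x *m J^T.

(* [metric_at x] is the Gram matrix of g_x on T_xM. *)
Record riemannian_metric (R : realType) (n : nat) (M : manifold R n) :=
  RiemannianMetric {
  metric_at :> M -> 'M[R]_n;
  metric_sym : forall x, (metric_at x)^T = metric_at x;
  metric_pos : forall x (u : 'rV[R]_n), u != 0 -> 0 < bil (metric_at x) u u;
  metric_smooth : forall c, atlas c ->
    smooth_on (chart_img c) (local_metric metric_at c)
}.

Definition along {R : realType} {n : nat} {W : normedModType R}
    (X : 'rV[R]_n -> 'rV[R]_n) (f : 'rV[R]_n -> W) : 'rV[R]_n -> W :=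
  fun y => \sum_(i < n) X y 0 i *: partial i f y.

Definition lie_bracket {R : realType} {n : nat}
    (X Y : 'rV[R]_n -> 'rV[R]_n) : 'rV[R]_n -> 'rV[R]_n :=
  fun y => along X Y y - along Y X y.

(* A connection is given by its symbols: Gam y i j is the value at y of the
   covariant derivative of the j-th coordinate field along the i-th one. *)
Definition covariant {R : realType} {n : nat}
    (Gam : 'rV[R]_n -> 'I_n -> 'I_n -> 'rV[R]_n)
    (X Y : 'rV[R]_n -> 'rV[R]_n) : 'rV[R]_n -> 'rV[R]_n :=
  fun y => along X Y y +
    \sum_(i < n) \sum_(j < n) (X y 0 i * Y y 0 j) *: Gam y i j.

Definition is_levi_civita {R : realType} {n : nat} (U : set 'rV[R]_n)
    (G : 'rV[R]_n -> 'M[R]_n) (Gam : 'rV[R]_n -> 'I_n -> 'I_n -> 'rV[R]_n) :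
    Prop :=
  (forall X Y, smooth_on U X -> smooth_on U Y -> forall y, U y ->
     covariant Gam X Y y - covariant Gam Y X y = lie_bracket X Y y) /\
  (forall X Y Z, smooth_on U X -> smooth_on U Y -> smooth_on U Z ->
     forall y, U y ->
     along X (fun z => bil (G z) (Y z) (Z z)) y =
       bil (G y) (covariant Gam X Y y) (Z y) +
       bil (G y) (Y y) (covariant Gam X Z y)).

(* The symbols of the Levi-Civita connection of G; [christoffel_levi_civita]
   and [levi_civita_christoffel] below show that they are the unique ones
   satisfying [is_levi_civita]. *)
Definition christoffel {R : realType} {n : nat} (G : 'rV[R]_n -> 'M[R]_n) :
    'rV[R]_n -> 'I_n -> 'I_n -> 'rV[R]_n :=
  fun y i j => \row_k (2^-1 * \sum_(l < n) invmx (G y) k l *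
    (partial i (fun z => G z j l) y + partial j (fun z => G z i l) y
     - partial l (fun z => G z i j) y)).

Lemma bilE {R : realType} {n : nat} (G : 'M[R]_n) (u v : 'rV[R]_n) :
  bil G u v = \sum_(i < n) \sum_(j < n) u 0 i * G i j * v 0 j.
Proof.
rewrite /bil mxE exchange_big /=; apply: eq_bigr => j _.
by rewrite !mxE mulr_suml.
Qed.

Lemma bilDl {R : realType} {n : nat} (G : 'M[R]_n) u1 u2 v :
  bil G (u1 + u2) v = bil G u1 v + bil G u2 v.
Proof. by rewrite /bil !mulmxDl mxE. Qed.

Lemma bilZl {R : realType} {n : nat} (G : 'M[R]_n) a u v :
  bil G (a *: u) v = a * bil G u v.
Proof. by rewrite /bil -!scalemxAl mxE. Qed.

Lemma bilDr {R : realType} {n : nat} (G : 'M[R]_n) u v1 v2 :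
  bil G u (v1 + v2) = bil G u v1 + bil G u v2.
Proof. by rewrite /bil linearD mulmxDr mxE. Qed.

Lemma bilZr {R : realType} {n : nat} (G : 'M[R]_n) a u v :
  bil G u (a *: v) = a * bil G u v.
Proof. by rewrite /bil linearZ -scalemxAr mxE. Qed.

Lemma bil_suml {R : realType} {n m : nat} (G : 'M[R]_n) (f : 'I_m -> 'rV[R]_n) v :
  bil G (\sum_i f i) v = \sum_i bil G (f i) v.
Proof. by rewrite /bil !mulmx_suml summxE. Qed.

Lemma bil_sumr {R : realType} {n m : nat} (G : 'M[R]_n) u (f : 'I_m -> 'rV[R]_n) :
  bil G u (\sum_i f i) = \sum_i bil G u (f i).
Proof. by rewrite /bil raddf_sum mulmx_sumr summxE. Qed.

Lemma bil_delta {R : realType} {n : nat} (G : 'M[R]_n) i j :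
  bil G (delta_mx 0 i) (delta_mx 0 j) = G i j.
Proof. by rewrite /bil -rowE trmx_delta -colE !mxE. Qed.

Lemma bil_sym {R : realType} {n : nat} (G : 'M[R]_n) u v :
  G^T = G -> bil G u v = bil G v u.
Proof.
move=> Gs; transitivity ((u *m G *m v^T)^T 0 0); first by rewrite [RHS]mxE.
by rewrite !trmx_mul trmxK Gs mulmxA.
Qed.

Lemma bil_row_delta {R : realType} {n : nat} (G : 'M[R]_n) u j :
  bil G u (delta_mx 0 j) = (u *m G) 0 j.
Proof. by rewrite /bil trmx_delta -colE mxE. Qed.

Lemma derive_bil {R : realType} {n : nat} (G : 'rV[R]_n -> 'M[R]_n)
    (Y Z : 'rV[R]_n -> 'rV[R]_n) (y v : 'rV[R]_n) :
  derivable G y v -> derivable Y y v -> derivable Z y v ->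
  'D_v (fun z => bil (G z) (Y z) (Z z)) y =
    bil ('D_v G y) (Y y) (Z y) + bil (G y) ('D_v Y y) (Z y)
    + bil (G y) (Y y) ('D_v Z y).
Proof.
move=> dG dY dZ.
have -> : (fun z => bil (G z) (Y z) (Z z)) =
    \sum_(i < n) \sum_(j < n)
      ((fun z => Y z 0 i) * (fun z => G z i j) * (fun z => Z z 0 j)).
  apply/funext => z; rewrite bilE fct_sumE; apply: eq_bigr => i _.
  by rewrite fct_sumE; apply: eq_bigr => j _; rewrite !fctE.
have dGij i j := (derivable_mxP G y v).1 dG i j.
have dYi i := (derivable_mxP Y y v).1 dY 0 i.
have dZi i := (derivable_mxP Z y v).1 dZ 0 i.
have dYG i j : derivable ((fun z => Y z 0 i) * (fun z => G z i j)) y v.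
  exact: derivableM.
have dYGZ i j :
  derivable ((fun z => Y z 0 i) * (fun z => G z i j) * (fun z => Z z 0 j)) y v.
  exact: derivableM.
rewrite derive_sum; last by move=> i; apply: derivable_sum.
rewrite !bilE -!big_split /=; apply: eq_bigr => i _.
rewrite derive_sum // -!big_split /=; apply: eq_bigr => j _.
rewrite deriveM // deriveM // derive_mx // (derive_mx dY) (derive_mx dZ) !mxE.
by rewrite /GRing.scale /= !fctE; ring.
Qed.

Lemma smooth_on_derivable {R : realType} {n : nat} {W : normedModType R}
    (U : set 'rV[R]_n) (f : 'rV[R]_n -> W) y i :
  smooth_on U f -> U y -> derivable f y (delta_mx 0 i).
Proof. by move=> /(_ 1%N)[_ /(_ i)[df _]] Uy; exact: df. Qed.

Lemma Ck_on_cst {R : realType} {n : nat} {W : normedModType R} k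
    (U : set 'rV[R]_n) (w : W) : Ck_on k U (cst w).
Proof.
have cw w' : forall y, U y -> {for y, continuous (cst w' : 'rV[R]_n -> W)}.
  by move=> y _; exact: (@cst_continuous _ _ w').
elim: k w => [|k IH] w; first by split=> //; exact: cw.
split=> [|i]; first exact: cw.
split=> [y _|]; first exact: derivable_cst.
suff -> : partial i (cst w) = cst 0 :> ('rV[R]_n -> W) by exact: IH.
by apply/funext => y; rewrite /partial derive_cst.
Qed.

Lemma smooth_on_cst {R : realType} {n : nat} {W : normedModType R}
    (U : set 'rV[R]_n) (w : W) : smooth_on U (cst w).
Proof. by move=> k; exact: Ck_on_cst. Qed.

Lemma along_cst {R : realType} {n : nat} {W : normedModType R}
    (X : 'rV[R]_n -> 'rV[R]_n) (w : W) y : along X (cst w) y = 0.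
Proof.
by rewrite /along big1 // => i _; rewrite /partial derive_cst scaler0.
Qed.

Lemma along_delta {R : realType} {n : nat} {W : normedModType R}
    (i : 'I_n) (f : 'rV[R]_n -> W) y :
  along (cst (delta_mx 0 i)) f y = partial i f y.
Proof.
rewrite /along (bigD1 i) //= mxE !eqxx scale1r big1 ?addr0 // => j ji.
by rewrite mxE (negbTE ji) andbF scale0r.
Qed.

Lemma covariant_delta {R : realType} {n : nat} Gam (i j : 'I_n) (y : 'rV[R]_n) :
  covariant Gam (cst (delta_mx 0 i)) (cst (delta_mx 0 j)) y = Gam y i j.
Proof.
rewrite /covariant along_cst add0r (bigD1 i) //= (bigD1 j) //= !mxE !eqxx.
rewrite mulr1 scale1r big1 ?addr0 => [|l lj]; last first.
  by rewrite !mxE (negbTE lj) andbF mulr0 scale0r.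
rewrite big1 ?addr0 // => k ki; rewrite big1 // => l _.
by rewrite !mxE (negbTE ki) andbF mul0r scale0r.
Qed.

Lemma bil_christoffel {R : realType} {n : nat} (G : 'rV[R]_n -> 'M[R]_n)
    (y : 'rV[R]_n) i j k :
  (G y)^T = G y -> G y \in unitmx ->
  bil (G y) (christoffel G y i j) (delta_mx 0 k) =
    2^-1 * (partial i (fun z => G z j k) y + partial j (fun z => G z i k) y
     - partial k (fun z => G z i j) y).
Proof.
move=> Gs Gu; rewrite bil_row_delta.
pose w : 'rV[R]_n := \row_l (partial i (fun z => G z j l) y +
  partial j (fun z => G z i l) y - partial l (fun z => G z i j) y).
have -> : christoffel G y i j = 2^-1 *: (w *m invmx (G y)).
  apply/rowP => l; rewrite !mxE; congr (_ * _); apply: eq_bigr => m _.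
  have invs : (invmx (G y))^T = invmx (G y) by rewrite trmx_inv Gs.
  by rewrite !mxE mulrC -[in LHS]invs mxE.
by rewrite -scalemxAl mulmxKV // !mxE.
Qed.

Lemma partial_sym {R : realType} {n : nat} (U : set 'rV[R]_n)
    (G : 'rV[R]_n -> 'M[R]_n) y i j k :
  open U -> (forall y, U y -> (G y)^T = G y) -> U y ->
  partial k (fun z => G z i j) y = partial k (fun z => G z j i) y.
Proof.
move=> oU Gs Uy; apply: near_eq_derive.
have : \forall z \near y, U z by exact: open_nbhs_nbhs.
by apply: filterS => z Uz; rewrite -[in LHS](Gs _ Uz) mxE.
Qed.

Theorem christoffel_levi_civita {R : realType} {n : nat} (U : set 'rV[R]_n)
    (G : 'rV[R]_n -> 'M[R]_n) :
  open U -> smooth_on U G -> (forall y, U y -> (G y)^T = G y) ->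
  (forall y, U y -> G y \in unitmx) ->
  is_levi_civita U G (christoffel G).
Proof.
move=> oU sG Gs Gu; split=> [X Y _ _|X Y Z sX sY sZ] y Uy.
  rewrite /covariant /lie_bracket opprD addrACA -[RHS]addr0; congr (_ + _).
  apply/eqP; rewrite subr_eq0 exchange_big /=; apply/eqP.
  apply: eq_bigr => i _; apply: eq_bigr => j _; rewrite mulrC; congr (_ *: _).
  apply/rowP => k; rewrite !mxE; congr (_ * _); apply: eq_bigr => l _.
  rewrite [partial l _ _](partial_sym _ _ _ oU Gs Uy).
  by rewrite [X in X - _]addrC.
have dmetric k i j : partial k (fun z => G z i j) y =
    bil (G y) (christoffel G y k i) (delta_mx 0 j) +
    bil (G y) (delta_mx 0 i) (christoffel G y k j).
  rewrite (bil_sym (delta_mx 0 i)) ?Gs // !bil_christoffel ?Gs ?Gu //.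
  rewrite (partial_sym j i _ oU Gs Uy) (partial_sym k i _ oU Gs Uy).
  rewrite (partial_sym k j _ oU Gs Uy).
  by field.
rewrite /covariant !bilDl !bilDr /along !bil_suml !bil_sumr addrACA.
under eq_bigr => k _.
  rewrite /partial derive_bil; try exact: smooth_on_derivable Uy.
  over.
rewrite -!big_split /=; apply: eq_bigr => k _.
rewrite !bilZl !bilZr bil_suml bil_sumr [in LHS]/GRing.scale /= !mulrDr.
rewrite -[LHS]addrA [LHS]addrC; congr (_ + _).
under [X in _ = X + _]eq_bigr do rewrite bilZl -mulrA.
under [X in _ = _ + X]eq_bigr do rewrite bilZr -mulrA.
rewrite -!mulr_sumr -mulrDr; congr (_ * _).
have dG i j : ('D_(delta_mx 0 k) G y) i j =
    bil (G y) (christoffel G y k i) (delta_mx 0 j) +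
    bil (G y) (delta_mx 0 i) (christoffel G y k j).
  by rewrite derive_mx ?mxE -?dmetric //; exact: smooth_on_derivable Uy.
rewrite bilE.
under eq_bigr => i _ do under eq_bigr => j _ do rewrite dG mulrDr mulrDl.
under eq_bigr => i _ do rewrite big_split /=.
rewrite big_split /=; congr (_ + _).
  apply: eq_bigr => i _.
  rewrite [in RHS](row_sum_delta (Z y)) bil_sumr mulr_sumr.
  by apply: eq_bigr => j _; rewrite bilZr; ring.
rewrite exchange_big /=; apply: eq_bigr => j _.
rewrite [in RHS](row_sum_delta (Y y)) bil_suml mulr_sumr.
by apply: eq_bigr => i _; rewrite bilZl; ring.
Qed.

Theorem levi_civita_christoffel {R : realType} {n : nat} (U : set 'rV[R]_n)
    (G : 'rV[R]_n -> 'M[R]_n) (Gam : 'rV[R]_n -> 'I_n -> 'I_n -> 'rV[R]_n) :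
  (forall y, U y -> (G y)^T = G y) -> (forall y, U y -> G y \in unitmx) ->
  is_levi_civita U G Gam ->
  forall y, U y -> Gam y = christoffel G y.
Proof.
move=> Gs Gu [tf mc] y Uy; apply/funext => i; apply/funext => j.
have Gsym k l : Gam y k l = Gam y l k.
  apply/eqP; rewrite -subr_eq0; apply/eqP.
  have := tf (cst (delta_mx 0 k)) (cst (delta_mx 0 l))
    (smooth_on_cst _ _) (smooth_on_cst _ _) y Uy.
  by rewrite !covariant_delta /lie_bracket !along_cst subrr.
have Gmet k l m : partial k (fun z => G z l m) y =
    bil (G y) (Gam y k l) (delta_mx 0 m) + bil (G y) (delta_mx 0 l) (Gam y k m).
  have := mc (cst (delta_mx 0 k)) (cst (delta_mx 0 l)) (cst (delta_mx 0 m))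
    (smooth_on_cst _ _) (smooth_on_cst _ _) (smooth_on_cst _ _) y Uy.
  rewrite along_delta !covariant_delta => <-; congr partial.
  by apply/funext => z; rewrite bil_delta.
have key k : bil (G y) (Gam y i j) (delta_mx 0 k) =
             bil (G y) (christoffel G y i j) (delta_mx 0 k).
  rewrite bil_christoffel ?Gs ?Gu // !Gmet !(bil_sym (delta_mx 0 _)) ?Gs //.
  rewrite (Gsym j i) (Gsym i k) (Gsym j k).
  by field.
apply: (can_inj (mulmxK (Gu _ Uy))); apply/rowP => k.
by rewrite -!bil_row_delta.
Qed.

Definition nabla {R : realType} {n : nat} (G : 'rV[R]_n -> 'M[R]_n) :=
  covariant (christoffel G).

(* Sign convention: R(X,Y)Z = nabla_[X,Y] Z - [nabla_X, nabla_Y] Z, for which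
   tr (Z |-> R(X,Z)Y) is the usual Ricci tensor (positive on round spheres). *)
Definition curvature {R : realType} {n : nat} (G : 'rV[R]_n -> 'M[R]_n)
    (X Y Z : 'rV[R]_n -> 'rV[R]_n) : 'rV[R]_n -> 'rV[R]_n :=
  fun y => nabla G (lie_bracket X Y) Z y
    - (nabla G X (nabla G Y Z) y - nabla G Y (nabla G X Z) y).

(* Tangent vectors at y are extended to fields with constant components; R being
   tensorial, the extension is immaterial. *)
Definition local_ricci {R : realType} {n : nat} (G : 'rV[R]_n -> 'M[R]_n)
    (y u v : 'rV[R]_n) : R :=
  \tr (lin1_mx (fun w : 'rV[R]_n => curvature G (cst u) (cst w) (cst v) y)).

Definition ricci {R : realType} {n : nat} {M : manifold R n}
    (g : riemannian_metric M) (x : M) (u v : 'rV[R]_n) : R :=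
  let c := chart_at x in local_ricci (local_metric g c) (chart_fun c x) u v.

Definition scalar_curvature {R : realType} {n : nat} {M : manifold R n}
    (g : riemannian_metric M) (x : M) : R :=
  \sum_(i < n) \sum_(j < n)
    invmx (g x) i j * ricci g x (delta_mx 0 i) (delta_mx 0 j).

Definition is_ricci_endo {R : realType} {n : nat} {M : manifold R n}
    (g : riemannian_metric M) (x : M) (A : 'M[R]_n) : Prop :=
  forall u v, bil (g x) (u *m A) v = ricci g x u v.

Definition ricci_eigenvalue {R : realType} {n : nat} {M : manifold R n}
    (g : riemannian_metric M) (x : M) (lambda : R) : Prop :=
  exists2 A : 'M[R]_n, is_ricci_endo g x A & eigenvalue A lambda.

Definition einstein {R : realType} {n : nat} {M : manifold R n}
    (g : riemannian_metric M) : Prop :=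
  exists lambda : R, forall X Y : M -> 'rV[R]_n,
    smooth_vector_field X -> smooth_vector_field Y ->
    forall x, ricci g x (X x) (Y x) = lambda * bil (g x) (X x) (Y x).

(* Main.v *)
Require Import Defs.
From mathcomp Require Import all_boot all_order all_algebra.
From mathcomp Require Import all_classical all_reals all_analysis.
From mathcomp Require Import ring lra.

Set Implicit Arguments.
Unset Strict Implicit.
Unset Printing Implicit Defensive.

Import Order.TTheory GRing.Theory Num.Theory.
Import numFieldNormedType.Exports.

Local Open Scope classical_set_scope.
Local Open Scope ring_scope.

(** The Ricci form is symmetric: in coordinates its only term that is not
    visibly symmetric is d_k (sum_i Gam^i_il) = d_k d_l (ln (det G)) / 2, which
    is symmetric by Schwarz's theorem.  Hence the minimum of r(u,u)/g(u,u) over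
    the unit sphere is an eigenvalue of r, and if it is at least s/n then
    r - (s/n) g is positive semidefinite.  As this form has g-trace zero, it
    vanishes. *)

(** * Locality of derivatives and entries of smooth maps *)

(** The error [f (z + y) - f y - z] vanishes for [z] near 0, so it is little-o and the differential
    is the identity. Transition maps of a chart with itself are of this kind: they are the identity
    only on the chart image. *)
Lemma diff_near_id {R : realType} {n : nat} (f : 'rV[R]_n -> 'rV[R]_n) y :
  (\forall z \near y, f z = z) -> 'J f y = 1%:M.
Proof.
move=> fid.
have fy : f y = y := nbhs_singleton fid.
have -> : 'J f y = lin1_mx (idfun : {linear 'rV[R]_n -> 'rV[R]_n}).
  rewrite /jacobian; congr lin1_mx; apply: diff_unique.
    by move=> z; exact: cvg_id.
  apply/eqaddoP => e e0; move: fid; rewrite (near_shift 0).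
  apply: filterS => z; rewrite /= subr0 => fz.
  rewrite !fctE /= fz fy [z + y]addrC subrr normr0 mulr_ge0 //.
  exact: ltW.
by apply/matrixP => i j; rewrite !mxE eq_sym.
Qed.

(** As [U] is open, agreement on [U] is agreement near each of its points, so the partial
    derivatives agree on [U] as well and the induction goes on. *)
Lemma Ck_on_ext {R : realType} {n : nat} {W : normedModType R} k
    (U : set 'rV[R]_n) (f h : 'rV[R]_n -> W) :
  open U -> {in U, f =1 h} -> Ck_on k U f -> Ck_on k U h.
Proof.
move=> oU.
have fh_near (f1 f2 : 'rV[R]_n -> W) y :
    {in U, f1 =1 f2} -> U y -> \forall z \near y, f1 z = f2 z.
  move=> f12 Uy; have : \forall z \near y, U z by exact: open_nbhs_nbhs.
  by apply: filterS => z Uz; apply: f12; exact: mem_set.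
have near_cont (f1 f2 : 'rV[R]_n -> W) y :
    {in U, f1 =1 f2} -> U y -> {for y, continuous f1} -> {for y, continuous f2}.
  move=> f12 Uy; rewrite /prop_for /continuous_at -(f12 y (mem_set Uy)) => cf1.
  have nf := fh_near _ _ _ f12 Uy.
  exact: (cvg_trans (@near_eq_cvg _ _ (nbhs y) _ _ _ nf) cf1).
elim: k f h => [|k IH] f h fh.
  by case=> cf _; split=> // y Uy; exact: near_cont fh Uy (cf y Uy).
case=> cf df; split=> [y Uy|i]; first exact: near_cont fh Uy (cf y Uy).
have [dfi Cfi] := df i; split=> [y Uy|].
  by apply: near_eq_derivable (dfi y Uy); exact: fh_near.
apply: IH Cfi => y /set_mem Uy; apply: near_eq_derive; exact: fh_near.
Qed.

Lemma Ck_on_coord {R : realType} {n p q : nat} k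
    (U : set 'rV[R]_n) (f : 'rV[R]_n -> 'M[R]_(p, q)) i j :
  open U -> Ck_on k U f -> Ck_on k U (fun y => f y i j).
Proof.
move=> oU; elim: k f => [|k IH] f [cf df].
  split=> // y Uy; apply: (@cvg_comp _ _ _ f (fun A : 'M[R]_(p, q) => A i j)).
    exact: (cf y Uy).
  exact: coord_continuous.
split=> [y Uy|l].
  apply: (@cvg_comp _ _ _ f (fun A : 'M[R]_(p, q) => A i j)).
    exact: (cf y Uy).
  exact: coord_continuous.
have [dfl Cl] := df l.
split=> [y Uy|]; first exact: (derivable_mxP _ _ _).1 (dfl y Uy) i j.
(* Taking an entry commutes with [partial l] where [f] is derivable, which is known on [U] alone. *)
apply: Ck_on_ext (IH _ Cl) => // y /set_mem Uy.
by rewrite /partial derive_mx ?mxE //; exact: dfl.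
Qed.

(** * Schwarz's theorem on mixed derivatives *)

Lemma is_derive_line {R : realType} {V W : normedModType R} (f : V -> W)
    (p v : V) (s : R) :
  derivable f (p + s *: v) v ->
  is_derive s 1 (fun t : R => f (p + t *: v)) ('D_v f (p + s *: v)).
Proof.
move=> df.
have E : (fun h : R => h^-1 *:
      (((fun t : R => f (p + t *: v)) \o shift s) (h *: 1) - f (p + s *: v))) =
    (fun h : R => h^-1 *:
      ((f \o shift (p + s *: v)) (h *: v) - f (p + s *: v))).
  apply/funext => h /=; congr (_ *: (f _ - _)).
  by rewrite -[h *: 1]/(h * 1) mulr1 scalerDl addrCA.
by constructor; [rewrite /derivable E | rewrite /derive E].
Qed.

Lemma MVT_line {R : realType} {V : normedModType R} (f : V -> R)
    (p v : V) (h : R) :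
  0 < h -> (forall s, 0 <= s <= h -> derivable f (p + s *: v) v) ->
  exists2 s, 0 < s < h & f (p + h *: v) - f p = 'D_v f (p + s *: v) * h.
Proof.
move=> h0 df.
have [||s] := @MVT R (fun t => f (p + t *: v))
  (fun t => 'D_v f (p + t *: v)) 0 h h0.
- move=> s; rewrite in_itv /= => /andP[s0 sh].
  by apply: is_derive_line; apply: df; rewrite !ltW.
- apply: derivable_within_continuous => s; rewrite in_itv /= => sh.
  by have [] := is_derive_line (df s sh).
by rewrite in_itv /= scale0r addr0 subr0 => sh E; exists s.
Qed.

Lemma is_derive_shift {R : realType} {V W : normedModType R} (f : V -> W)
    (p w v : V) :
  derivable f (p + w) v -> is_derive p v (fun z => f (z + w)) ('D_v f (p + w)).
Proof.
move=> df.
have E : (fun h : R => h^-1 *: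
      (((fun z => f (z + w)) \o shift p) (h *: v) - f (p + w))) =
    (fun h : R => h^-1 *: ((f \o shift (p + w)) (h *: v) - f (p + w))).
  by apply/funext => h /=; rewrite addrA.
by constructor; [rewrite /derivable E | rewrite /derive E].
Qed.

(** The mean value theorem is used twice: along [u] for the function sending [z] to
    [f (z + h *: v) - f z], then along [v] for ['D_u f]. *)
Lemma second_difference {R : realType} {V : normedModType R} (f : V -> R)
    (y u v : V) (h : R) :
  0 < h ->
  (forall s t, 0 <= s <= h -> 0 <= t <= h ->
     derivable f (y + s *: u + t *: v) u /\
     derivable ('D_u f) (y + s *: u + t *: v) v) ->
  exists s t, [/\ 0 < s < h, 0 < t < h &
    f (y + h *: u + h *: v) - f (y + h *: u) - (f (y + h *: v) - f y) =
    'D_v ('D_u f) (y + s *: u + t *: v) * h * h].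
Proof.
move=> h0 df; have hh : 0 <= h <= h by rewrite lexx ltW.
have zh : 0 <= (0 : R) <= h by rewrite lexx ltW.
have dshift s : 0 <= s <= h ->
    is_derive (y + s *: u) u ((fun z => f (z + h *: v)) - f)
      ('D_u f (y + s *: u + h *: v) - 'D_u f (y + s *: u)).
  move=> sh; apply: is_deriveB.
    by apply: is_derive_shift; exact: (df s h sh hh).1.
  by apply: derivableP; have [+ _] := df s 0 sh zh; rewrite scale0r addr0.
have [s sh E] := @MVT_line _ _ _ y u h h0
  (fun s sh => @ex_derive _ _ _ _ _ _ _ (dshift s sh)).
have sh' : 0 <= s <= h by case/andP: sh => *; rewrite !ltW.
have [|t th F] := @MVT_line _ _ ('D_u f) (y + s *: u) v h h0.
  by move=> t th; case: (df s t sh' th).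
exists s, t; split=> //.
move: E; rewrite !fctE => ->.
by have [_ ->] := dshift s sh'; rewrite F.
Qed.

(** If [p y] and [q y] differed, then near [y] each function would stay within half their distance
    of its value at [y], so [p z] could not equal [q w]. *)
Lemma continuous_eq_near {R : realType} {V : normedModType R} (p q : V -> R)
    (y : V) :
  {for y, continuous p} -> {for y, continuous q} ->
  (forall d, 0 < d ->
    exists z w, [/\ `|y - z| < d, `|y - w| < d & p z = q w]) ->
  p y = q y.
Proof.
move=> cp cq close; apply/eqP; rewrite -subr_eq0 -normr_eq0.
apply: contraT => ab0.
have e0 : 0 < `|p y - q y| / 2 by rewrite divr_gt0 // lt_def ab0 normr_ge0.
have /cvgr_dist_lt/(_ _ e0) np := cp.
have /cvgr_dist_lt/(_ _ e0) nq := cq.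
have [d /= d0 Hd] := (nbhs_normP _ _).1 (filterI np nq).
have [z [w [yz yw pq]]] := close d d0.
have [A _] := Hd _ yz; have [_ B] := Hd _ yw.
move: A; rewrite pq => A.
have := ler_distD (q w) (p y) (q y); rewrite leNgt [`|q w - _|]distrC.
by have := ltrD A B; rewrite -splitr => ->.
Qed.

(** The double difference of [f] over a parallelogram is symmetric in [u] and [v]. By
    [second_difference] it is, up to the same factor, a value of either mixed derivative inside the
    parallelogram, which can be taken arbitrarily small. *)
Lemma schwarz {R : realType} {V : normedModType R} (f : V -> R) (y u v : V) :
  (\forall z \near y, derivable f z u /\ derivable f z v) ->
  (\forall z \near y, derivable ('D_u f) z v /\ derivable ('D_v f) z u) ->
  {for y, continuous ('D_v ('D_u f))} -> {for y, continuous ('D_u ('D_v f))} ->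
  'D_v ('D_u f) y = 'D_u ('D_v f) y.
Proof.
move=> d1 d2 cvu cuv; apply: continuous_eq_near cvu cuv _ => e e0.
have [d /= d0 Hd] := (nbhs_normP _ _).1 (filterI d1 d2).
have de0 : 0 < Num.min d e by rewrite lt_min d0.
have [c h0 inball] : exists2 c, 0 < c &
    forall s t : R, 0 <= s <= c -> 0 <= t <= c ->
      `|y - (y + s *: u + t *: v)| < Num.min d e.
  (* The summand 1 keeps the denominator positive when [u] and [v] vanish, and makes the final
     estimate strict. *)
  have uv0 : 0 < `|u| + `|v| + 1 by rewrite ltr_wpDl // addr_ge0.
  exists (Num.min d e / (`|u| + `|v| + 1)); first by rewrite divr_gt0.
  move=> s t /andP[s0 sh] /andP[t0 th].
  rewrite -addrA opprD addNKr normrN.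
  apply: (le_lt_trans (ler_normD _ _)); rewrite !normrZ !ger0_norm //.
  apply: (@le_lt_trans _ _ (Num.min d e / (`|u| + `|v| + 1) * (`|u| + `|v|))).
    by rewrite mulrDr lerD // ler_wpM2r.
  rewrite -[ltRHS](@divfK _ (`|u| + `|v| + 1)) ?gt_eqF //.
  rewrite ltr_pM2l ?divr_gt0 // ltrDl.
  exact: ltr01.
have dmin : Num.min d e <= d by rewrite ge_min lexx.
have emin : Num.min d e <= e by rewrite ge_min lexx orbT.
have inH s t (sc : 0 <= s <= c) (tc : 0 <= t <= c) :=
  Hd _ (lt_le_trans (inball s t sc tc) dmin).
have swap s t : y + s *: u + t *: v = y + t *: v + s *: u by rewrite addrAC.
have [|s [t [sh th E]]] := @second_difference _ _ f y u v c h0.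
  move=> s t sh th; have [[du _] [duv _]] := inH s t sh th.
  exact: (conj du duv).
have [|t' [s' [th' sh' F]]] := @second_difference _ _ f y v u c h0.
  move=> s' t' sh' th'; have := inH t' s' th' sh'.
  by rewrite (swap t' s') => -[[_ dv] [_ dvu]]; exact: (conj dv dvu).
have W q : 0 < q < c -> 0 <= q <= c by case/andP => *; rewrite !ltW.
exists (y + s *: u + t *: v), (y + s' *: u + t' *: v); split.
- exact: lt_le_trans (inball s t (W _ sh) (W _ th)) emin.
- exact: lt_le_trans (inball s' t' (W _ sh') (W _ th')) emin.
(* Multiplied by [c] twice, both sides become the double difference over the same parallelogram. *)
- apply: (mulIf (lt0r_neq0 h0)); apply: (mulIf (lt0r_neq0 h0)).
  rewrite [in RHS](swap s' t') -[RHS]F -[LHS]E [in LHS](swap c c).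
  have comm4 (a1 a2 a3 a4 : R) :
      a1 - a2 - (a3 - a4) = a1 - a3 - (a2 - a4) by ring.
  exact: comm4.
Qed.

(** * Calculus of determinants, inverses and products of matrices *)

Lemma determinant_continuous {R : realType} {n : nat} :
  continuous (fun A : 'M[R]_n => \det A).
Proof.
rewrite /determinant.
apply: (@continuous_big _ _ _ _ _ add_continuous) => s _ A.
apply: (@cvgM _ _ (nbhs A)); first exact: cvg_cst.
by apply: (@continuous_big _ _ _ _ _ mul_continuous) => i _;
  exact: coord_continuous.
Qed.

Lemma near_unitmx {R : realType} {n : nat} {T : topologicalType}
    (G : T -> 'M[R]_n) y :
  {for y, continuous G} -> G y \in unitmx -> \forall z \near y, G z \in unitmx.
Proof.
move=> cG; rewrite unitmxE unitfE => Gy.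
have cd : {for y, continuous (fun z => \det (G z))}.
  by apply: (@cvg_comp _ _ _ G _ _ _ _ cG); exact: determinant_continuous.
have : \forall z \near y, \det (G z) != 0 by exact: (cvgr_neq0 _ cd Gy).
by apply: filterS => z; rewrite unitmxE unitfE.
Qed.

(** The operation is left arbitrary so that both the sum and the products of the Leibniz formula for
    [\det] are instances. *)
Lemma derivable_big {R : realType} {V : normedModType R} {I : Type} (r : seq I)
    (op : R -> R -> R) (idx : R) (h : I -> V -> R) x v :
  (forall f k : V -> R, derivable f x v -> derivable k x v ->
     derivable (fun z => op (f z) (k z)) x v) ->
  (forall i, derivable (h i) x v) ->
  derivable (fun z => \big[op/idx]_(i <- r) h i z) x v.
Proof.
move=> dop dh; elim: r => [|i r IH].
  have -> : (fun z => \big[op/idx]_(i <- [::]) h i z) = cst idx.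
    by apply/funext => z; rewrite big_nil.
  exact: derivable_cst.
have -> : (fun z => \big[op/idx]_(j <- i :: r) h j z) =
    (fun z => op (h i z) (\big[op/idx]_(j <- r) h j z)).
  by apply/funext => z; rewrite big_cons.
exact: dop (dh i) IH.
Qed.

Lemma derivable_det {R : realType} {V : normedModType R} {n : nat}
    (F : V -> 'M[R]_n) x v :
  derivable F x v -> derivable (fun z => \det (F z)) x v.
Proof.
move=> /derivable_mxP dF; apply: derivable_big => [f k|s].
  exact: derivableD.
apply: derivableM; first exact: derivable_cst.
by apply: derivable_big => [f k|i]; [exact: derivableM | exact: dF].
Qed.

(** Cramer's formula writes the inverse as cofactors over the determinant. [invmx] returns its
    argument when that is singular, so the formula needs invertibility in a whole neighbourhood. *)
Lemma derivable_invmx {R : realType} {V : normedModType R} {n : nat}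
    (F : V -> 'M[R]_n) x v :
  (\forall z \near x, F z \in unitmx) -> derivable F x v ->
  derivable (fun z => invmx (F z)) x v.
Proof.
move=> Fu dF; apply/derivable_mxP => i j.
have Fux : F x \in unitmx := nbhs_singleton Fu.
apply: (@near_eq_derivable _ _ _
  ((fun z => (\det (F z))^-1) * (fun z => cofactor (F z) j i))).
  by apply: filterS Fu => z Fz; rewrite /invmx Fz !mxE.
apply: derivableM.
  by apply: derivableV; [rewrite -unitfE -unitmxE | exact: derivable_det].
apply: derivableM; first exact: derivable_cst.
apply: derivable_det; apply/derivable_mxP => k l.
under eq_fun do rewrite !mxE.
by move/derivable_mxP: dF; apply.
Qed.

Lemma is_derive_mulmx {R : realType} {V : normedModType R} {m n p : nat}
    (A : V -> 'M[R]_(m, n)) (B : V -> 'M[R]_(n, p)) x v :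
  derivable A x v -> derivable B x v ->
  is_derive x v (fun z => A z *m B z) ('D_v A x *m B x + A x *m 'D_v B x).
Proof.
move=> dA dB.
have dAij := (derivable_mxP _ _ _).1 dA.
have dBij := (derivable_mxP _ _ _).1 dB.
have dT i j k : derivable ((fun z => A z i k) * (fun z => B z k j)) x v.
  exact: derivableM.
have E i j : (fun z => (A z *m B z) i j) =
    \sum_k ((fun z => A z i k) * (fun z => B z k j)).
  by apply/funext => z; rewrite mxE fct_sumE.
have dAB : derivable (fun z => A z *m B z) x v.
  by apply/derivable_mxP => i j; rewrite E; exact: derivable_sum.
apply: DeriveDef => //; rewrite derive_mx //; apply/matrixP => i j.
rewrite mxE E derive_sum // !mxE -big_split /=; apply: eq_bigr => k _.
rewrite deriveM // (derive_mx dA) (derive_mx dB) !mxE addrC.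
by rewrite /GRing.scale /= [B x k j * _]mulrC.
Qed.

(** Differentiate the identity [F z *m invmx (F z) = 1%:M], valid near [x], and solve for the
    derivative of the inverse. *)
Lemma derive_invmx {R : realType} {V : normedModType R} {n : nat}
    (F : V -> 'M[R]_n) x v :
  (\forall z \near x, F z \in unitmx) -> derivable F x v ->
  'D_v (fun z => invmx (F z)) x = - (invmx (F x) *m 'D_v F x *m invmx (F x)).
Proof.
move=> Fu dF; have Fux : F x \in unitmx := nbhs_singleton Fu.
have [_ E] := is_derive_mulmx dF (derivable_invmx Fu dF).
have : 'D_v (fun z => F z *m invmx (F z)) x = 0.
  rewrite -(derive_cst (1%:M : 'M[R]_n) x v); apply: near_eq_derive.
  by apply: filterS Fu => z Fz; rewrite mulmxV.
rewrite E addrC => /eqP; rewrite addr_eq0.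
move=> /eqP /(congr1 (mulmx (invmx (F x)))).
by rewrite mulKmx // mulmxN !mulmxA.
Qed.

(** * Partial derivatives and the trace of the Christoffel symbols *)

Lemma partial_coord {R : realType} {n p q : nat} (U : set 'rV[R]_n)
    (f : 'rV[R]_n -> 'M[R]_(p, q)) l i j y :
  smooth_on U f -> U y -> partial l (fun z => f z i j) y = partial l f y i j.
Proof.
move=> sf Uy; have df := smooth_on_derivable (i := l) sf Uy.
by rewrite /partial (derive_mx df) mxE.
Qed.

Lemma smooth_on_coord {R : realType} {n p q : nat} (U : set 'rV[R]_n)
    (f : 'rV[R]_n -> 'M[R]_(p, q)) i j :
  open U -> smooth_on U f -> smooth_on U (fun z => f z i j).
Proof. by move=> oU sf k; exact: Ck_on_coord. Qed.

Lemma smooth_on_partial {R : realType} {n : nat} {W : normedModType R}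
    (U : set 'rV[R]_n) (f : 'rV[R]_n -> W) i :
  smooth_on U f -> smooth_on U (partial i f).
Proof. by move=> sf k; case: (sf k.+1) => _ /(_ i)[]. Qed.

Lemma partialC {R : realType} {n : nat} (U : set 'rV[R]_n)
    (f : 'rV[R]_n -> R) i j y :
  open U -> smooth_on U f -> U y ->
  partial i (partial j f) y = partial j (partial i f) y.
Proof.
move=> oU sf Uy; have nU : \forall z \near y, U z by exact: open_nbhs_nbhs.
have sp k := smooth_on_partial k sf.
apply: schwarz.
- by apply: filterS nU => z Uz; split; exact: smooth_on_derivable Uz.
- by apply: filterS nU => z Uz; split; apply: smooth_on_derivable Uz; exact: sp.
- by case: (smooth_on_partial i (sp j) 0%N) => /(_ _ Uy).
- by case: (smooth_on_partial j (sp i) 0%N) => /(_ _ Uy).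
Qed.

(** Symmetry of [G] at every point makes the entries [(i, j)] and [(j, i)] equal as functions, so
    their derivatives can be interchanged by rewriting. *)
Lemma christoffel_sym {R : realType} {n : nat} (G : 'rV[R]_n -> 'M[R]_n) y i j :
  (forall z, (G z)^T = G z) -> christoffel G y i j = christoffel G y j i.
Proof.
move=> Gs; apply/rowP => k; rewrite !mxE; congr (_ * _); apply: eq_bigr => l _.
have Gsf : (fun z => G z i j) = (fun z => G z j i).
  by apply/funext => z; rewrite -[in LHS]Gs mxE.
by rewrite Gsf; congr (_ * (_ - _)); exact: addrC.
Qed.

(** In the contraction the terms in [partial i] and [partial l] cancel, because [invmx (G y)] is
    symmetric; the term in [partial j] remains. The value is the [j]-th derivative of half the
    logarithm of [\det G]. *)
Lemma christoffel_trace {R : realType} {n : nat} (U : set 'rV[R]_n)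
    (G : 'rV[R]_n -> 'M[R]_n) y j :
  smooth_on U G -> U y -> (forall z, (G z)^T = G z) ->
  \sum_i christoffel G y i j 0 i = 2^-1 * \tr (invmx (G y) *m partial j G y).
Proof.
move=> sG Uy Gs.
have Gsf k l : (fun z => G z k l) = (fun z => G z l k).
  by apply/funext => z; rewrite -[in LHS]Gs mxE.
have Is k l : invmx (G y) k l = invmx (G y) l k.
  by rewrite -[in LHS](Gs y) -trmx_inv mxE.
under eq_bigr do rewrite mxE.
rewrite -mulr_sumr; congr (_ * _).
under eq_bigr do under eq_bigr do rewrite mulrBr mulrDr.
under eq_bigr do rewrite sumrB big_split /=.
rewrite sumrB big_split /= [X in X + _ - _]exchange_big /=.
rewrite addrAC [X in X - _](_ : _ = \sum_i \sum_l invmx (G y) i l *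
   partial l (fun z => G z i j) y); last first.
  by apply: eq_bigr => i _; apply: eq_bigr => l _; rewrite Is Gsf.
rewrite subrr add0r; apply: eq_bigr => i _; rewrite mxE; apply: eq_bigr => l _.
by rewrite Gsf (partial_coord _ _ _ sG).
Qed.

(** * Positive definite and semidefinite forms *)

Lemma posdef_unitmx {R : realType} {n : nat} (G : 'M[R]_n) :
  (forall u, u != 0 -> 0 < bil G u u) -> G \in unitmx.
Proof.
move=> Gp; rewrite -row_free_unit -kermx_eq0; apply/rowV0P => v /sub_kermxP vG.
apply: contraTeq isT => /Gp; by rewrite /bil vG mul0mx mxE ltxx.
Qed.

(** A basis orthonormal for [G], by induction on the size; it serves to turn the [G]-trace of a form
    into an ordinary trace. *)
Lemma posdef_cholesky {R : realType} {n : nat} (G : 'M[R]_n) :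
  G^T = G -> (forall u, u != 0 -> 0 < bil G u u) ->
  exists2 P : 'M[R]_n, P \in unitmx & P *m G *m P^T = 1%:M.
Proof.
elim: n G => [|n IH] G Gs Gp.
  by exists 1%:M; [exact: unitmx1 | rewrite [LHS]flatmx0 [RHS]flatmx0].
pose H : 'M[R]_(1 + n) := G.
have Hs : H^T = H := Gs.
pose a := ulsubmx H 0 0.
have Ea : ulsubmx H = a%:M by rewrite [LHS]mx11_scalar.
pose b := ursubmx H; pose D := drsubmx H.
have Eb : dlsubmx H = b^T by rewrite /b trmx_ursub Hs.
have Ds : D^T = D by rewrite /D trmx_drsub Hs.
have EH : H = block_mx a%:M b b^T D by rewrite -Ea -Eb submxK.
have a0 : 0 < a.
  have := Gp (delta_mx 0 0).
  rewrite bil_delta /a !mxE lshift0; apply.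
  by apply/eqP => /rowP/(_ 0); rewrite !mxE eqxx => /eqP; rewrite oner_eq0.
(* L clears the off-diagonal blocks of G, leaving a Schur complement. *)
pose L : 'M[R]_(1 + n) := block_mx 1%:M 0 (- a^-1 *: b^T) 1%:M.
have LH : L *m H *m L^T = block_mx a%:M 0 0 (D - a^-1 *: (b^T *m b)).
  rewrite EH /L tr_block_mx !mulmx_block !trmx1 !trmx0 linearZ /= trmxK.
  rewrite !mul1mx !mul0mx !mulmx0 !mulmx1 !addr0 -!scalemxAl !mul_mx_scalar.
  rewrite !mul_scalar_mx !scalerA !mulrN mulfV ?gt_eqF // mulNr.
  rewrite mulVf ?gt_eqF //.
  by rewrite !scaleN1r !addNr mul0mx add0r addrC scaleNr.
have Lu : L \in unitmx by rewrite unitmxE det_lblock !det1 mulr1 unitr1.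
have Gb (P : 'M[R]_(1 + n)) u :
    bil H (u *m P) (u *m P) = bil (P *m H *m P^T) u u.
  by rewrite /bil trmx_mul !mulmxA.
(* The Schur complement is the form [H] evaluated on the vectors [row_mx 0 u *m L], hence inherits
   positivity. *)
have Sp u : u != 0 -> 0 < bil (D - a^-1 *: (b^T *m b)) u u.
  move=> u0; have w0 : row_mx (0 : 'rV_1) u *m L != 0.
    apply: contra_neq u0 => /(congr1 (mulmx^~ (invmx L))).
    rewrite mulmxK // mul0mx.
    by rewrite -[in RHS](row_mx0) => /eq_row_mx[].
  have := Gp _ w0; rewrite (Gb L) LH /bil mul_row_block tr_row_mx.
  by rewrite !mul0mx !mulmx0 trmx0 !addr0 !add0r mul_row_col mul0mx add0r.
have [|Q Qu QS] := IH _ _ Sp.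
  by rewrite linearB linearZ /= trmx_mul trmxK Ds.
(* [N] normalises the corner [a] to 1 and applies the inductive basis [Q] to the Schur
   complement. *)
pose N : 'M[R]_(1 + n) := block_mx (Num.sqrt a)^-1%:M 0 0 Q.
have Nu : N \in unitmx.
  rewrite unitmxE det_lblock det_scalar1 unitrM -unitmxE Qu.
  by rewrite andbT unitfE invr_eq0 sqrtr_eq0 -ltNge.
exists (N *m L); first by rewrite (@unitmx_mul R (1 + n)) Nu.
have -> : N *m L *m G *m (N *m L)^T = N *m (L *m H *m L^T) *m N^T.
  by rewrite trmx_mul !mulmxA.
rewrite LH /N tr_block_mx !mulmx_block !trmx0 !mul0mx !mulmx0 !addr0 !add0r.
rewrite mul0mx QS tr_scalar_mx -!scalar_mxM.
have -> : (Num.sqrt a)^-1 * a * (Num.sqrt a)^-1 = 1.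
  have sa0 : Num.sqrt a != 0 by rewrite sqrtr_eq0 -ltNge.
  by rewrite -{2}(sqr_sqrtr (ltW a0)); field.
by rewrite mul0mx -scalar_mx_block.
Qed.

(** The form at [u + t *: v] is a quadratic in [t] without constant term; being nonnegative for all
    [t], it has linear coefficient zero. *)
Lemma psd_isotropic {R : realType} {n : nat} (B : 'M[R]_n) (u : 'rV[R]_n) :
  B^T = B -> (forall v, 0 <= bil B v v) -> bil B u u = 0 -> u *m B = 0.
Proof.
move=> Bs B0 uu; apply/rowP => j; rewrite -bil_row_delta mxE.
set v := delta_mx 0 j.
have H t : 0 <= 2 * t * bil B u v + t ^+ 2 * bil B v v.
  have := B0 (u + t *: v).
  rewrite bilDl !bilDr !bilZl !bilZr uu (bil_sym v u Bs); lra.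
(* The minimiser would be - b / c; c + 1 avoids the case c = 0. *)
set b := bil B u v in H *; set c := bil B v v in H.
have c0 : 0 <= c := B0 v.
have := H (- b / (c + 1)); have c1 : c + 1 != 0 by rewrite gt_eqF // ltr_wpDl.
have -> : 2 * (- b / (c + 1)) * b + (- b / (c + 1)) ^+ 2 * c =
  - (b ^+ 2 * (c + 2)) / (c + 1) ^+ 2 by field.
rewrite pmulr_lge0 ?invr_gt0 ?exprn_even_gt0 // oppr_ge0.
rewrite pmulr_lle0 ?ltr_wpDl //.
move=> b2; apply/eqP; rewrite -sqrf_eq0 eq_le b2 sqr_ge0 //.
Qed.

(** The diagonal entries are nonnegative with sum zero, so every basis vector is isotropic and lies
    in the kernel. *)
Lemma psd_trace0 {R : realType} {n : nat} (B : 'M[R]_n) :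
  B^T = B -> (forall v, 0 <= bil B v v) -> \tr B = 0 -> B = 0.
Proof.
move=> Bs B0 tr0; apply/row_matrixP => i; rewrite rowE row0.
apply: psd_isotropic => //.
have : forall i, true -> B i i = 0.
  apply: psumr_eq0P => // j _; rewrite -bil_delta; exact: B0.
by rewrite bil_delta; apply.
Qed.

(** With [P] from [posdef_cholesky] the inverse of [G] is [P^T *m P], so the trace in question is
    that of the congruent form [P *m B *m P^T]. *)
Lemma psd_trace_invmx0 {R : realType} {n : nat} (G B : 'M[R]_n) :
  G^T = G -> (forall u, u != 0 -> 0 < bil G u u) ->
  B^T = B -> (forall v, 0 <= bil B v v) -> \tr (B *m invmx G) = 0 -> B = 0.
Proof.
move=> Gs Gp Bs B0 tr0; have [P Pu PG] := posdef_cholesky Gs Gp.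
have iG : invmx G = P^T *m P.
  have [u1 _] : P *m G \in unitmx /\ P^T \in unitmx := mulmx1_unit PG.
  have Gu : G \in unitmx by move: u1; rewrite unitmx_mul => /andP[].
  apply: (can_inj (mulKmx Gu)); rewrite mulmxV //.
  apply: (can_inj (mulKmx Pu)); rewrite mulmx1 !mulmxA PG mul1mx //.
have : P *m B *m P^T = 0.
  apply: psd_trace0.
  - by rewrite !trmx_mul trmxK Bs mulmxA.
  - move=> v; have := B0 (v *m P); rewrite /bil trmx_mul !mulmxA //.
  - by rewrite -mulmxA mxtrace_mulC -mulmxA -iG.
move=> /(congr1 (mulmx (invmx P)))/(congr1 (mulmx^~ (invmx P^T))).
by rewrite !mulmxA mulVmx // mul1mx mulmxK ?unitmx_tr // mulmx0 mul0mx.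
Qed.

(** * The Rayleigh quotient and the least eigenvalue *)

Lemma bil_continuous {R : realType} {n : nat} (B : 'M[R]_n) :
  continuous (fun u : 'rV[R]_n => bil B u u).
Proof.
have -> : (fun u : 'rV[R]_n => bil B u u) =
    (fun u => \sum_(i < n) \sum_(j < n) u 0 i * B i j * u 0 j).
  by apply/funext => u; rewrite bilE.
apply: (@continuous_big _ _ _ _ _ add_continuous) => i _.
apply: (@continuous_big _ _ _ _ _ add_continuous) => j _ u.
apply: (@cvgM _ _ (nbhs u)); last exact: coord_continuous.
by apply: (@cvgM _ _ (nbhs u)); [exact: coord_continuous | exact: cvg_cst].
Qed.

(* mu is the minimum of the Rayleigh quotient on the unit sphere. *)
Lemma rayleigh_min {R : realType} {n : nat} (G B : 'M[R]_n) :
  (0 < n)%N -> (forall u, u != 0 -> 0 < bil G u u) ->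
  exists mu, (exists2 u, u != 0 & bil B u u = mu * bil G u u) /\
     (forall v, mu * bil G v v <= bil B v v).
Proof.
move=> n0 Gp.
(* The norm is the sup norm of the coordinates, not the one given by [G]. This suffices: its unit
   sphere is compact and meets every ray, and [f] is constant along rays. *)
pose f u := bil B u u / bil G u u.
pose A := [set u : 'rV[R]_n | `|u| = 1].
have nA u : u != 0 -> A (`|u|^-1 *: u).
  by move=> u0; rewrite /A /= normrZ normfV normr_id mulVf // normr_eq0.
have An u : A u -> u != 0.
  by move=> Au; rewrite -normr_eq0 Au oner_neq0.
have A0 : A !=set0.
  exists (`|delta_mx 0 (Ordinal n0) : 'rV[R]_n|^-1 *: delta_mx 0 (Ordinal n0)).
  apply: nA; apply/eqP => /rowP/(_ (Ordinal n0)); rewrite !mxE !eqxx => /eqP.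
  by rewrite oner_eq0.
have Ac : compact A.
  apply: bounded_closed_compact.
    by exists 1; split; [exact: num_real | move=> M M1 x /= ->; exact: ltW].
  apply: (@closed_comp _ _ (fun u : 'rV[R]_n => `|u|) [set 1]) => //.
  by move=> u _; exact: norm_continuous.
have fc : {within A, continuous f}.
  apply: continuous_in_subspaceT => u /set_mem /An u0.
  apply: (@cvgM _ _ (nbhs u)); first exact: bil_continuous.
  apply: (@cvgV _ _ (nbhs u)); last exact: bil_continuous.
  by rewrite gt_eqF // Gp.
have [u /set_mem Au umin] := EVT_min_rV A0 Ac fc.
exists (f u); split.
  by exists u; [exact: An | rewrite /f divfK // gt_eqF // Gp // An].
move=> v; have [->|v0] := eqVneq v 0; first by rewrite /bil !mul0mx !mxE mulr0.
have := umin _ (mem_set (nA _ v0)).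
have -> : f (`|v|^-1 *: v) = f v.
  have nv : `|v| != 0 by rewrite normr_eq0.
  have /gt_eqF/negbT G0 := Gp _ v0.
  by rewrite /f !bilZl !bilZr; field; apply/andP.
by rewrite {2}/f ler_pdivlMr // Gp.
Qed.

Lemma bil_subZ {R : realType} {n : nat} (B G : 'M[R]_n) (a : R) u v :
  bil (B - a *: G) u v = bil B u v - a * bil G u v.
Proof. by rewrite /bil mulmxBr mulmxBl -scalemxAr -scalemxAl !mxE. Qed.

(** A minimiser [u] of the Rayleigh quotient is isotropic for the semidefinite form [B - mu *: G],
    hence in its kernel; cancelling [G] gives [u *m A = mu *: u]. *)
Lemma min_eigenvalue {R : realType} {n : nat} (G B A : 'M[R]_n) :
  (0 < n)%N -> G^T = G -> (forall u, u != 0 -> 0 < bil G u u) -> B^T = B ->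
  A *m G = B ->
  exists2 mu, eigenvalue A mu & (forall v, mu * bil G v v <= bil B v v).
Proof.
move=> n0 Gs Gp Bs AG.
have [mu [[u u0 uB] muB]] := rayleigh_min B n0 Gp.
exists mu => //; apply/eigenvalueP; exists u => //.
have uC : u *m (B - mu *: G) = 0.
  apply: psd_isotropic; first by rewrite linearB linearZ /= Bs Gs.
    by move=> v; rewrite bil_subZ subr_ge0.
  by rewrite bil_subZ uB subrr.
apply: (can_inj (mulmxK (posdef_unitmx Gp))).
apply/eqP; rewrite -mulmxA AG -subr_eq0 -scalemxAl.
by move: uC; rewrite mulmxBr -scalemxAr => ->.
Qed.

Lemma eigenvalues_ge_mean {R : realType} {n : nat} (G B : 'M[R]_n) :
  G^T = G -> (forall u, u != 0 -> 0 < bil G u u) -> B^T = B ->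
  (forall mu, eigenvalue (B *m invmx G) mu ->
    n%:R^-1 * \tr (B *m invmx G) <= mu) ->
  B = (n%:R^-1 * \tr (B *m invmx G)) *: G.
Proof.
(* In dimension 0 there is no eigenvalue to minimise, but all matrices are equal. *)
case: n G B => [|n] G B; first by move=> *; rewrite [LHS]flatmx0 [RHS]flatmx0.
move=> Gs Gp Bs eig; set s := _ * \tr _.
have Gu := posdef_unitmx Gp.
have [||mu emu muB] := @min_eigenvalue _ _ G B (B *m invmx G) _ Gs Gp Bs => //.
  by rewrite mulmxKV.
apply/eqP; rewrite -subr_eq0; apply/eqP.
apply: (psd_trace_invmx0 Gs Gp).
- by rewrite linearB linearZ /= Bs Gs.
- move=> v; rewrite bil_subZ subr_ge0.
  apply: le_trans (muB v); rewrite ler_wpM2r ?eig //.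
  have [->|/Gp/ltW//] := eqVneq v 0; by rewrite /bil !mul0mx mxE.
(* The trace of [G *m invmx G] is the dimension, which cancels the factor in [s]. *)
- rewrite mulmxBl -scalemxAl mulmxV // linearB linearZ /= mxtrace1 /s.
  by rewrite mulrAC mulVf ?mul1r ?subrr // pnatr_eq0.
Qed.

(** * Symmetry of the differentiated Christoffel trace *)

Lemma is_derive_tr {R : realType} {V : normedModType R} {n : nat}
    (F : V -> 'M[R]_n) x v :
  derivable F x v -> is_derive x v (fun z => \tr (F z)) (\tr ('D_v F x)).
Proof.
move=> dF; have dFij := (derivable_mxP _ _ _).1 dF.
have E : (fun z => \tr (F z)) = \sum_i (fun z => F z i i).
  by apply/funext => z; rewrite fct_sumE.
apply: DeriveDef; rewrite E; first exact: derivable_sum.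
by rewrite derive_sum // (derive_mx dF); apply: eq_bigr => i _; rewrite mxE.
Qed.

(** The logarithm of the determinant is avoided by differentiating the formula of
    [christoffel_trace]. This yields two traces: one with both first derivatives of [G], symmetric
    by cyclicity, and one with the second derivative of [G], symmetric by Schwarz. *)
Lemma partial_christoffel_trace_sym {R : realType} {n : nat} (U : set 'rV[R]_n)
    (G : 'rV[R]_n -> 'M[R]_n) y k j :
  open U -> smooth_on U G -> U y -> (forall z, (G z)^T = G z) ->
  G y \in unitmx ->
  partial k (fun z => \sum_i christoffel G z i j 0 i) y =
  partial j (fun z => \sum_i christoffel G z i k 0 i) y.
Proof.
move=> oU sG Uy Gs Gu.
have nU : \forall z \near y, U z by exact: open_nbhs_nbhs.
have nG : \forall z \near y, G z \in unitmx.
  by apply: near_unitmx => //; case: (sG 0%N) => /(_ _ Uy).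
have dG l : derivable G y (delta_mx 0 l) by exact: smooth_on_derivable Uy.
have dpG l m : derivable (partial l G) y (delta_mx 0 m).
  by apply: smooth_on_derivable Uy; exact: smooth_on_partial.
have E l m : partial l (fun z => \sum_i christoffel G z i m 0 i) y =
    2^-1 * (\tr (- (invmx (G y) *m partial l G y *m invmx (G y)) *m
              partial m G y) +
            \tr (invmx (G y) *m partial l (partial m G) y)).
  rewrite /partial (@near_eq_derive _ _ _ _
    (2^-1 \*: (fun z => \tr (invmx (G z) *m partial m G z)))); last first.
    by apply: filterS nU => z Uz; rewrite (christoffel_trace _ sG Uz Gs).
  have dI := derivable_invmx nG (dG l).
  have [dM DM] := is_derive_mulmx dI (dpG m l).
  have [dT DT] := is_derive_tr dM.
  by rewrite (deriveZ _ dT) DT DM linearD /= (derive_invmx nG (dG l)).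
have trC (A B I : 'M[R]_n) :
    \tr (- (I *m A *m I) *m B) = \tr (- (I *m B *m I) *m A).
  rewrite !mulNmx !raddfN /=; congr (- _).
  by rewrite -(mulmxA (I *m A)) (mxtrace_mulC (I *m A)) mulmxA.
(* Schwarz's theorem concerns real functions, so it is applied entry by entry. *)
have ppC : partial k (partial j G) y = partial j (partial k G) y.
  apply/matrixP => a b.
  have pc l m : partial l (partial m G) y a b =
      partial l (partial m (fun z => G z a b)) y.
    rewrite -(partial_coord _ _ _ (smooth_on_partial m sG) Uy).
    apply: near_eq_derive; apply: filterS nU => z Uz.
    by rewrite (partial_coord _ _ _ sG Uz).
  apply: etrans (pc k j) _; apply: etrans _ (esym (pc j k)).
  exact: (partialC k j oU (smooth_on_coord a b oU sG) Uy).
apply: etrans (E k j) (etrans _ (esym (E j k))).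
exact: (congr2 (fun p q => 2^-1 * (p + \tr (invmx (G y) *m q)))
  (trC _ _ _) ppC).
Qed.

(** * The Ricci tensor in coordinates *)

Lemma derivable_christoffel {R : realType} {n : nat} (U : set 'rV[R]_n)
    (G : 'rV[R]_n -> 'M[R]_n) y i j m :
  open U -> smooth_on U G -> U y -> G y \in unitmx ->
  derivable (fun z => christoffel G z i j) y (delta_mx 0 m).
Proof.
move=> oU sG Uy Gu; apply/derivable_mxP => a k.
have nG : \forall z \near y, G z \in unitmx.
  by apply: near_unitmx => //; case: (sG 0%N) => /(_ _ Uy).
have dG : derivable G y (delta_mx 0 m) by exact: smooth_on_derivable Uy.
have dI := (derivable_mxP _ _ _).1 (derivable_invmx nG dG).
have dp p q r : derivable (partial p (fun z => G z q r)) y (delta_mx 0 m).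
  apply: smooth_on_derivable Uy; apply: smooth_on_partial.
  exact: smooth_on_coord.
have -> : (fun z => christoffel G z i j a k) = 2^-1 \*: (\sum_l
   ((fun z => invmx (G z) k l) * (partial i (fun z => G z j l) +
     partial j (fun z => G z i l) - partial l (fun z => G z i j)))).
  by apply/funext => z; rewrite mxE /= fct_sumE.
apply: derivableZ; apply: derivable_sum => l; apply: derivableM.
  exact: (dI k l).
exact: (derivableB (derivableD (dp _ _ _) (dp _ _ _)) (dp _ _ _)).
Qed.

Lemma nabla_cst {R : realType} {n : nat} (G : 'rV[R]_n -> 'M[R]_n)
    (u v : 'rV[R]_n) :
  nabla G (cst u) (cst v) =
  \sum_i \sum_j (u 0 i * v 0 j) \*: (fun z => christoffel G z i j).
Proof.
apply/funext => z; rewrite /nabla /covariant along_cst add0r fct_sumE.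
by apply: eq_bigr => i _; rewrite fct_sumE.
Qed.

(* The covariant derivative along d_a of the covariant derivative of d_l along
   d_k. *)
Definition nabla2 {R : realType} {n : nat} (G : 'rV[R]_n -> 'M[R]_n) y
    (a k l : 'I_n) : 'rV[R]_n :=
  partial a (fun z => christoffel G z k l) y +
  \sum_m christoffel G y k l 0 m *: christoffel G y a m.

(** Constant components pass through all derivatives, so the iterated covariant derivative is
    trilinear in them, with coefficients [nabla2]. *)
Lemma nabla_nabla_cst {R : realType} {n : nat} (U : set 'rV[R]_n)
    (G : 'rV[R]_n -> 'M[R]_n) y (u w v : 'rV[R]_n) :
  open U -> smooth_on U G -> U y -> G y \in unitmx ->
  nabla G (cst u) (nabla G (cst w) (cst v)) y =
  \sum_a \sum_k \sum_l (u 0 a * w 0 k * v 0 l) *: nabla2 G y a k l.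
Proof.
move=> oU sG Uy Gu.
have dC m i j := derivable_christoffel (i := i) (j := j) (m := m) oU sG Uy Gu.
rewrite nabla_cst {1}/nabla /covariant /along -big_split /=.
apply: eq_bigr => a _.
have -> : partial a (\sum_i \sum_j (w 0 i * v 0 j) \*:
      (fun z => christoffel G z i j)) y =
    \sum_i \sum_j (w 0 i * v 0 j) *: partial a (fun z => christoffel G z i j) y.
  rewrite /partial derive_sum => [|i]; last first.
    by apply: derivable_sum => j; exact: derivableZ.
  apply: eq_bigr => i _; rewrite derive_sum => [|j]; last exact: derivableZ.
  by apply: eq_bigr => j _; rewrite deriveZ.
rewrite scaler_sumr.
have -> : \sum_j (u 0 a * (\sum_i \sum_j (w 0 i * v 0 j) \*:
      (fun z => christoffel G z i j)) y 0 j) *: christoffel G y a j =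
    \sum_k \sum_l (u 0 a * w 0 k * v 0 l) *:
      \sum_m christoffel G y k l 0 m *: christoffel G y a m.
  under [RHS]eq_bigr do under eq_bigr do rewrite scaler_sumr.
  under [RHS]eq_bigr do rewrite exchange_big /=.
  rewrite [RHS]exchange_big /=; apply: eq_bigr => m _.
  rewrite fct_sumE summxE mulr_sumr scaler_suml; apply: eq_bigr => k _.
  rewrite fct_sumE summxE mulr_sumr scaler_suml; apply: eq_bigr => l _.
  by rewrite /= mxE scalerA !mulrA.
rewrite -big_split /=; apply: eq_bigr => k _.
rewrite scaler_sumr -big_split /=; apply: eq_bigr => l _.
by rewrite scalerA mulrA /nabla2 scalerDr.
Qed.

(** The classical components, summed over [i] and [m]: d_i Gam^i_kl - d_k Gam^i_il + Gam^m_kl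
    Gam^i_im - Gam^m_il Gam^i_km. *)
Definition ricci_mx {R : realType} {n : nat} (G : 'rV[R]_n -> 'M[R]_n) y :
    'M[R]_n :=
  \matrix_(k, l) \sum_i (nabla2 G y i k l - nabla2 G y k i l) 0 i.

(** Constant fields commute, so the bracket term of the curvature drops out. Putting the [i]-th
    basis vector for [w] and reading off the [i]-th component gives the contraction in
    [ricci_mx]. *)
Lemma local_ricciE {R : realType} {n : nat} (U : set 'rV[R]_n)
    (G : 'rV[R]_n -> 'M[R]_n) y u v :
  open U -> smooth_on U G -> U y -> G y \in unitmx ->
  local_ricci G y u v = bil (ricci_mx G y) u v.
Proof.
move=> oU sG Uy Gu.
have sumd (f : 'I_n -> 'rV[R]_n) i :
    \sum_a (delta_mx 0 i : 'rV[R]_n) 0 a *: f a = f i.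
  rewrite (bigD1 i) //= mxE !eqxx scale1r big1 ?addr0 // => a ai.
  by rewrite mxE (negbTE ai) andbF scale0r.
have curv w : curvature G (cst u) (cst w) (cst v) y =
    nabla G (cst w) (nabla G (cst u) (cst v)) y -
    nabla G (cst u) (nabla G (cst w) (cst v)) y.
  rewrite /curvature.
  have -> : lie_bracket (cst u) (cst w) = cst 0.
    by apply/funext => z; rewrite /lie_bracket !along_cst subrr.
  rewrite [nabla G (cst 0) _]nabla_cst !fct_sumE big1 ?sub0r ?opprB // => i _.
  by rewrite fct_sumE big1 // => j _; rewrite /= mxE mul0r scale0r.
rewrite /local_ricci bilE /mxtrace.
under eq_bigr => i _.
  rewrite mxE curv !(nabla_nabla_cst _ _ _ oU sG Uy Gu).
  have -> : \sum_a \sum_k \sum_l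
      ((delta_mx 0 i : 'rV[R]_n) 0 a * u 0 k * v 0 l) *: nabla2 G y a k l =
    \sum_k \sum_l (u 0 k * v 0 l) *: nabla2 G y i k l.
    rewrite -[RHS](sumd
      (fun a => \sum_k \sum_l (u 0 k * v 0 l) *: nabla2 G y a k l)).
    apply: eq_bigr => a _; rewrite scaler_sumr; apply: eq_bigr => k _.
    by rewrite scaler_sumr; apply: eq_bigr => l _; rewrite scalerA mulrA.
  have -> : \sum_a \sum_k \sum_l
      (u 0 a * (delta_mx 0 i : 'rV[R]_n) 0 k * v 0 l) *: nabla2 G y a k l =
    \sum_k \sum_l (u 0 k * v 0 l) *: nabla2 G y k i l.
    apply: eq_bigr => k _.
    rewrite -[RHS](sumd (fun a => \sum_l (u 0 k * v 0 l) *: nabla2 G y k a l)).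
    apply: eq_bigr => a _; rewrite scaler_sumr; apply: eq_bigr => l _.
    by rewrite scalerA; congr (_ *: _); ring.
  rewrite -sumrB summxE.
  over.
rewrite exchange_big /=; apply: eq_bigr => k _.
under eq_bigr do rewrite -sumrB summxE.
rewrite exchange_big /=; apply: eq_bigr => l _.
rewrite mxE mulr_sumr mulr_suml; apply: eq_bigr => i _.
by rewrite -scalerBr mxE; exact: mulrAC.
Qed.

Lemma ricci_mx_sym {R : realType} {n : nat} (U : set 'rV[R]_n)
    (G : 'rV[R]_n -> 'M[R]_n) y :
  open U -> smooth_on U G -> U y -> (forall z, (G z)^T = G z) ->
  G y \in unitmx ->
  (ricci_mx G y)^T = ricci_mx G y.
Proof.
move=> oU sG Uy Gs Gu.
pose C i j m := christoffel G y i j 0 m.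
pose dC a i j m := partial a (fun z => christoffel G z i j) y 0 m.
have Cs i j : christoffel G y i j = christoffel G y j i.
  exact: christoffel_sym.
have CC i j m : C i j m = C j i m by rewrite /C Cs.
have n2C a k l : nabla2 G y a k l = nabla2 G y a l k.
  have Ckl : (fun z => christoffel G z k l) = (fun z => christoffel G z l k).
    by apply/funext => z; exact: christoffel_sym.
  rewrite /nabla2 (Cs k l).
  exact: (congr1 (fun f => partial a f y + _) Ckl).
have n2E a k l i : nabla2 G y a k l 0 i = dC a k l i + \sum_m C k l m * C a m i.
  by rewrite mxE summxE; congr (_ + _); apply: eq_bigr => m _; rewrite mxE.
(* Three pieces, each symmetric for its own reason: [n2S] by the symmetry of the lower indices,
   [dCC] by the differentiated trace, [CCC] by renaming indices. *)
have RE k l : ricci_mx G y k l = \sum_i nabla2 G y i k l 0 i -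
    (\sum_i dC k i l i + \sum_i \sum_m C i l m * C k m i).
  rewrite mxE -big_split -sumrB /=; apply: eq_bigr => i _.
  by rewrite -n2E mxE; congr (_ + _); rewrite mxE.
have dCC k l : \sum_i dC k i l i = \sum_i dC l i k i.
  have tr a b : \sum_i dC a i b i =
      partial a (fun z => \sum_i christoffel G z i b 0 i) y.
    have dCi i : derivable (fun z => christoffel G z i b) y (delta_mx 0 a).
      exact: derivable_christoffel oU sG Uy Gu.
    have -> : (fun z => \sum_i christoffel G z i b 0 i) =
        \sum_i (fun z => christoffel G z i b 0 i).
      by apply/funext => z; rewrite fct_sumE.
    rewrite /partial derive_sum => [|i].
      by apply: eq_bigr => i _; rewrite /dC /partial (derive_mx (dCi i)) mxE.
    exact: (derivable_mxP _ _ _).1 (dCi i) 0 i.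
  have trC := partial_christoffel_trace_sym k l oU sG Uy Gs Gu.
  exact: etrans (tr k l) (etrans trC (esym (tr l k))).
have n2S k l : \sum_i nabla2 G y i k l 0 i = \sum_i nabla2 G y i l k 0 i.
  by apply: eq_bigr => i _; rewrite n2C.
have CCC k l : \sum_i \sum_m C i l m * C k m i =
    \sum_i \sum_m C i k m * C l m i.
  rewrite exchange_big /=; apply: eq_bigr => m _; apply: eq_bigr => i _.
  by rewrite (CC i l) (CC k m) mulrC.
apply/matrixP => l k; rewrite [LHS]mxE (RE k l) (RE l k).
exact: (congr2 (fun p q : R => p - q) (n2S k l)
  (congr2 +%R (dCC k l) (CCC k l))).
Qed.

(** * Passage to the manifold and conclusion *)

Lemma chart_atP {R : realType} {n : nat} {M : manifold R n} (x : M) :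
  atlas (chart_at x) /\ chart_dom (chart_at x) x.
Proof. exact: (projT2 (cid (atlas_cover x))). Qed.

(** Near the point the transition map from the chart to itself is the identity, so the Jacobian
    matrices around [g x] are trivial. *)
Lemma local_metric_chart_at {R : realType} {n : nat} {M : manifold R n}
    (g : riemannian_metric M) (x : M) :
  local_metric g (chart_at x) (chart_fun (chart_at x) x) = g x.
Proof.
have [_ xc] := chart_atP x; set c := chart_at x in xc *.
have cK : chart_inv c (chart_fun c x) = x by apply: chart_funK; exact: mem_set.
rewrite /local_metric cK -/c /coord_change.
rewrite diff_near_id ?trmx1 ?mul1mx ?mulmx1 //.
have : \forall z \near chart_fun c x, chart_img c z.
  by apply: open_nbhs_nbhs; split; [exact: chart_img_open | exists x].
by apply: filterS => z [t tc <-] /=; rewrite chart_funK //; exact: mem_set.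
Qed.

Theorem theorem3p2 (R : realType) (n : nat) (M : manifold R n)
    (g : riemannian_metric M)
    (scal_const : exists s : R, forall x : M, scalar_curvature g x = s)
    (eig_ge : forall (x : M) (lambda : R), ricci_eigenvalue g x lambda ->
       n%:R^-1 * scalar_curvature g x <= lambda) :
  einstein g.
Proof.
have [s scal] := scal_const; exists (n%:R^-1 * s) => X Y _ _ x.
have [ac xc] := chart_atP x; set c := chart_at x in ac xc.
pose y := chart_fun c x; pose G := local_metric g c.
have Gy : G y = g x by exact: local_metric_chart_at.
have oU : open (chart_img c) by exact: chart_img_open.
have Uy : chart_img c y by exists x.
have sG : smooth_on (chart_img c) G by exact: metric_smooth.
(* This holds for all [z], even off the chart image, because [G z] has the form
   [J *m g x *m J^T]. *)
have Gs z : (G z)^T = G z.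
  by rewrite /G /local_metric !trmx_mul trmxK Defs.metric_sym mulmxA.
have gu : g x \in unitmx := posdef_unitmx (@metric_pos _ _ _ g x).
have Gu : G y \in unitmx by rewrite Gy.
pose B := ricci_mx G y.
have ricE u v : ricci g x u v = bil B u v by exact: local_ricciE Uy Gu.
have Bs : B^T = B by exact: ricci_mx_sym Uy Gs Gu.
have trB : \tr (B *m invmx (g x)) = s.
  rewrite -(scal x) /scalar_curvature exchange_big; apply: eq_bigr => i _.
  rewrite mxE; apply: eq_bigr => j _; rewrite ricE bil_delta.
  by rewrite -[in LHS]Bs mxE; exact: mulrC.
have -> : ricci g x (X x) (Y x) = bil B (X x) (Y x) by exact: ricE.
suff -> : B = (n%:R^-1 * s) *: g x.
  by rewrite /bil -scalemxAr -scalemxAl mxE.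
rewrite -trB; apply: eigenvalues_ge_mean => //.
- exact: Defs.metric_sym.
- exact: metric_pos.
rewrite trB => mu emu; rewrite -(scal x); apply: eig_ge.
(* Endomorphisms act on row vectors from the right, so the Ricci endomorphism is [B] followed by the
   inverse metric. *)
exists (B *m invmx (g x)) => // u v.
by rewrite ricE /bil mulmxA mulmxKV.
Qed.
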